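(* Let $d>1$ be an integer and let $d_1$ be a (positive) divisor of $d$. Let $H=\ker\big((\mathbb{Z}/d)^\times\to(\mathbb{Z}/d_1)^\times\big)$. Let $f(x)\in\mathbb{Q}(x)$ be such that $[1]+[-1]\in\operatorname{Ann}_{\mathbb{Z}[\mathbb{Z}^\circ]}(f)$. Let $\alpha=\alpha_1\alpha_2$ with $\alpha_1,\alpha_2\in\mathbb{Z}[\mathbb{Z}^\circ]$. Suppose that: (1) $f$ is defined at $\zeta_d^a$ for each $a\in\operatorname{Supp}(\alpha_1)$; (2) for all $h\in\mathbb{Z}$ with $\overline{h}\in H$, we have $\phi_d\big(([h]-[1])\alpha_1\big)\in\phi_d(\langle[1]+[-1]\rangle)$; (3) for each $a\in\operatorname{Supp}(\alpha_2)$, $\gcd(a,d)=1$. Then the following statements hold. (a) If $\alpha_2\equiv0 \bmod [d_1]$, then $\Phi_d$ is a factor of $\alpha f$. (b) Let $g(x)=f(x)-f(-x)$. Suppose further that $d_1=4d_0$ is a multiple of $4$, that $d/d_1$ is odd, and that $\alpha_1g(\zeta_d)=0$. If $\alpha_2\equiv0\bmod[d_1/2]$, then $\Phi_d$ is a factor of $\alpha f$.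
   Context: $\mathbb{Z}^\circ$ is the multiplicative monoid of nonzero integers, and $\mathbb{Z}[\mathbb{Z}^\circ]$ is its integral monoid ring: finite formal sums $\alpha=\sum_m a_m[m]$ with $a_m\in\mathbb{Z}$, and multiplication extending $[m][n]=[mn]$. $\operatorname{Supp}(\alpha)=\{m : a_m\neq 0\}$. The ring acts on $\mathbb{Q}(x)$ by $(\alpha f)(x)=\sum_m a_m f(x^m)$, and $\operatorname{Ann}_{\mathbb{Z}[\mathbb{Z}^\circ]}(f)=\{r : rf=0\}$. $\langle[1]+[-1]\rangle$ is the principal ideal of $\mathbb{Z}[\mathbb{Z}^\circ]$ generated by $[1]+[-1]$. $(\mathbb{Z}/d)^\circ$ is the multiplicative monoid of all residue classes mod $d$ (including $0$), and $\phi_d:\mathbb{Z}[\mathbb{Z}^\circ]\to\mathbb{Z}[(\mathbb{Z}/d)^\circ]$ is the ring homomorphism induced by $[m]\mapsto[m\bmod d]$. For a positive integer $m$, $\alpha\equiv\beta\bmod[m]$ means that $\alpha-\beta=\sum_k n_k([a_k]-[b_k])$ for some $n_k\in\mathbb{Z}$ and $a_k,b_k\in\mathbb{Z}^\circ$ with $a_k\equiv b_k\pmod m$ for every $k$. $\zeta_d$ is a primitive $d$-th root of unity in $\mathbb{C}$ and $\Phi_d$ is the $d$-th cyclotomic polynomial. $F\in\mathbb{Q}(x)$ is defined at $\xi\in\mathbb{C}$ if $\xi$ is not a pole of $F$. $\Phi_d$ is a factor of $F$ if $F=P/Q$ with $P,Q\in\mathbb{Q}[x]$, $\Phi_d\mid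 P$, $\Phi_d\nmid Q$; equivalently, $F$ is defined at $\zeta_d$ and $F(\zeta_d)=0$. *)

(* Defs.v *)
From HB Require Import structures.
From mathcomp Require Import all_boot all_order all_fingroup all_algebra all_field.
From mathcomp Require Import finmap.
From mathcomp.multinomials Require Import monalg.
From mathcomp Require Import reals complex.

Set Implicit Arguments.
Unset Strict Implicit.
Unset Printing Implicit Defensive.

Import GRing.Theory.
Local Open Scope ring_scope.

(* [{malg int[G]}] is only a ring in the library when [G] has no nontrivial
   units (monomType), which excludes the monoids needed here; hence this alias,
   equipped with the convolution product for an arbitrary monoid. *)
Definition monring (G : monoidType) : Type := {malg int[G]}.

HB.instance Definition _ (G : monoidType) := GRing.Zmodule.on (monring G).

Section MonoidRing.
Variable G : monoidType.
Implicit Types (a b c : monring G) (m n : G).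

Definition mr_scaled (z : int) (m : G) : monring G := << z *g m >>.
Definition mr_of (m : G) : monring G := mr_scaled 1 m.
Definition mr_coef a (m : G) : int := mcoeff m a.
Definition mr_supp a : {fset G} := msupp a.

Definition mr_mul a b : monring G :=
  \sum_(m <- mr_supp a) \sum_(n <- mr_supp b)
     mr_scaled (mr_coef a m * mr_coef b n) (m * n)%g.

Lemma mr_scaled0 m : mr_scaled 0 m = 0. Proof. exact: monalgU0. Qed.

Lemma mr_scaledD m x y : mr_scaled (x + y) m = mr_scaled x m + mr_scaled y m.
Proof. exact: monalgUD. Qed.

Lemma mr_sumw (V : nmodType) (F : G -> int -> V) a (A : {fset G}) :
    (forall m, F m 0 = 0) -> (mr_supp a `<=` A)%fset ->
  \sum_(m <- mr_supp a) F m (mr_coef a m) = \sum_(m <- A) F m (mr_coef a m).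
Proof.
move=> F0 sA; apply: big_fset_incl => // m _ nm.
by rewrite /mr_coef mcoeff_outdom // F0.
Qed.

Lemma mr_sumD (V : nmodType) (F : G -> int -> V) a b :
    (forall m, F m 0 = 0) -> (forall m x y, F m (x + y) = F m x + F m y) ->
  \sum_(m <- mr_supp (a + b)) F m (mr_coef (a + b) m) =
  \sum_(m <- mr_supp a) F m (mr_coef a m) +
  \sum_(m <- mr_supp b) F m (mr_coef b m).
Proof.
move=> F0 FD; set A := (mr_supp a `|` mr_supp b)%fset.
rewrite (mr_sumw (A := A) F0); last exact: msuppD_le.
rewrite (mr_sumw (a := a) (A := A) F0) ?fsubsetUl //.
rewrite (mr_sumw (a := b) (A := A) F0) ?fsubsetUr //.
by rewrite -big_split; apply: eq_bigr => m _; rewrite /mr_coef mcoeffD FD.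
Qed.

Lemma mr_sumU (V : nmodType) (F : G -> int -> V) z n :
    (forall m, F m 0 = 0) ->
  \sum_(m <- mr_supp (mr_scaled z n)) F m (mr_coef (mr_scaled z n) m) = F n z.
Proof.
move=> F0; rewrite (mr_sumw (A := [fset n]%fset) F0); last exact: msuppU_le.
by rewrite big_seq_fset1 /mr_coef mcoeffUU.
Qed.

Lemma mrE a : a = \sum_(m <- mr_supp a) mr_scaled (mr_coef a m) m.
Proof. exact: monalgE. Qed.


Lemma mr_mulDl : left_distributive mr_mul +%R.
Proof.
move=> a b c; rewrite /mr_mul.
apply: (mr_sumD (F := fun m x => \sum_(n <- mr_supp c)
  mr_scaled (x * mr_coef c n) (m * n)%g)) => [m|m x y].
  by rewrite big1 // => n _; rewrite mul0r mr_scaled0.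
by rewrite -big_split; apply: eq_bigr => n _; rewrite mulrDl mr_scaledD.
Qed.

Lemma mr_mulDr : right_distributive mr_mul +%R.
Proof.
move=> a b c; rewrite /mr_mul -big_split; apply: eq_bigr => m _ /=.
apply: (mr_sumD (F := fun n x => mr_scaled (mr_coef a m * x) (m * n)%g)).
  by move=> n; rewrite mulr0 mr_scaled0.
by move=> n x y; rewrite mulrDr mr_scaledD.
Qed.

Lemma mr_mulUU x y m n :
  mr_mul (mr_scaled x m) (mr_scaled y n) = mr_scaled (x * y) (m * n)%g.
Proof.
rewrite /mr_mul (mr_sumU (F := fun k z => \sum_(l <- mr_supp (mr_scaled y n))
  mr_scaled (z * mr_coef (mr_scaled y n) l) (k * l)%g)) => [|k].
  rewrite (mr_sumU (F := fun l z => mr_scaled (x * z) (m * l)%g)) // => l.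
  by rewrite mulr0 mr_scaled0.
by rewrite big1 // => l _; rewrite mul0r mr_scaled0.
Qed.

Lemma mr_mul0r : left_zero 0 mr_mul.
Proof. by move=> a; rewrite /mr_mul /mr_supp msupp0 big_seq_fset0. Qed.

Lemma mr_mulr0 : right_zero 0 mr_mul.
Proof.
by move=> a; rewrite /mr_mul big1 // => m _; rewrite /mr_supp msupp0 big_seq_fset0.
Qed.

Lemma mr_mul_suml I (r : seq I) (F : I -> monring G) b :
  mr_mul (\sum_(i <- r) F i) b = \sum_(i <- r) mr_mul (F i) b.
Proof. exact: (big_morph (mr_mul^~ b) (fun x y => mr_mulDl x y b) (mr_mul0r b)). Qed.

Lemma mr_mul_sumr I (r : seq I) (F : I -> monring G) a :
  mr_mul a (\sum_(i <- r) F i) = \sum_(i <- r) mr_mul a (F i).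
Proof. exact: (big_morph (mr_mul a) (mr_mulDr a) (mr_mulr0 a)). Qed.

Lemma mr_mulA : associative mr_mul.
Proof.
move=> a b c; rewrite [a]mrE !mr_mul_suml; apply: eq_bigr => m _.
rewrite [b]mrE !(mr_mul_suml, mr_mul_sumr); apply: eq_bigr => n _.
rewrite [c]mrE !(mr_mul_suml, mr_mul_sumr); apply: eq_bigr => k _.
by rewrite !mr_mulUU mulrA mulgA.
Qed.

Lemma mr_mul1l : left_id (mr_of 1%g) mr_mul.
Proof.
move=> a; rewrite [a]mrE mr_mul_sumr; apply: eq_bigr => m _.
by rewrite mr_mulUU mul1r mul1g.
Qed.

Lemma mr_mul1r : right_id (mr_of 1%g) mr_mul.
Proof.
move=> a; rewrite [a]mrE mr_mul_suml; apply: eq_bigr => m _.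
by rewrite mr_mulUU mulr1 mulg1.
Qed.

Lemma mr_one_neq0 : mr_of 1%g != 0.
Proof. by rewrite /mr_of /mr_scaled monalgU_eq0. Qed.

HB.instance Definition _ := GRing.Zmodule_isNzRing.Build (monring G)
  mr_mulA mr_mul1l mr_mul1r mr_mulDl mr_mulDr mr_one_neq0.

End MonoidRing.

(* The map Z[G] -> Z[H] induced by a map phi : G -> H. *)
Definition mr_map (G H : monoidType) (phi : G -> H) (a : monring G) : monring H :=
  \sum_(m <- mr_supp a) mr_scaled (mr_coef a m) (phi m).

Section MonoidRingMap.
Variables (G H : monoidType) (phi : G -> H).

Lemma mr_mapU z m : mr_map phi (mr_scaled z m) = mr_scaled z (phi m).
Proof.
by apply: (mr_sumU (F := fun k x => mr_scaled x (phi k))) => k; exact: mr_scaled0.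
Qed.

Lemma mr_mapD : {morph mr_map phi : a b / a + b}.
Proof.
move=> a b; apply: (mr_sumD (F := fun k x => mr_scaled x (phi k))) => [m|m x y].
  exact: mr_scaled0.
exact: mr_scaledD.
Qed.

Lemma mr_map0 : mr_map phi 0 = 0.
Proof. by rewrite /mr_map /mr_supp msupp0 big_seq_fset0. Qed.

Lemma mr_map_sum I (r : seq I) (F : I -> monring G) :
  mr_map phi (\sum_(i <- r) F i) = \sum_(i <- r) mr_map phi (F i).
Proof. exact: (big_morph _ mr_mapD mr_map0). Qed.

Lemma mr_mapM :
  {morph phi : m n / (m * n)%g} -> {morph mr_map phi : a b / a * b}.
Proof.
move=> phiM a b; rewrite [a]mrE mr_map_sum !mulr_suml mr_map_sum.
apply: eq_bigr => m _; rewrite [b]mrE mr_map_sum !mulr_sumr mr_map_sum.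
by apply: eq_bigr => n _; rewrite !mr_mapU [_ * _]mr_mulUU mr_mapU phiM [RHS]mr_mulUU.
Qed.

End MonoidRingMap.

Record nzint := NZInt { nzval :> int; nzvalP : nzval != 0 }.
HB.instance Definition _ := [isSub for nzval].
HB.instance Definition _ := [Choice of nzint by <:].

Definition nz_one : nzint := NZInt (oner_neq0 int).
Definition nz_mone : nzint := NZInt (isT : -1 != 0 :> int).
Definition nz_mul (m n : nzint) : nzint := NZInt (mulf_neq0 (nzvalP m) (nzvalP n)).

Fact nz_mulA : associative nz_mul.
Proof. by move=> m n k; apply: val_inj; exact: mulrA. Qed.
Fact nz_mul1l : left_id nz_one nz_mul.
Proof. by move=> m; apply: val_inj; exact: mul1r. Qed.
Fact nz_mul1r : right_id nz_one nz_mul.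
Proof. by move=> m; apply: val_inj; exact: mulr1. Qed.
HB.instance Definition _ := isMonoid.Build nzint nz_mulA nz_mul1l nz_mul1r.

Notation ZZnz := (monring nzint).

Fact ZZnz_mulC : commutative (@GRing.mul ZZnz).
Proof.
move=> a b; rewrite [a]mrE [b]mrE !mulr_suml.
under eq_bigr do rewrite mulr_sumr.
rewrite exchange_big; apply: eq_bigr => n _ /=; rewrite mulr_sumr.
apply: eq_bigr => m _; rewrite [LHS]mr_mulUU [RHS]mr_mulUU mulrC; congr mr_scaled.
by apply: val_inj; exact: mulrC.
Qed.
HB.instance Definition _ := GRing.PzRing_hasCommutativeMul.Build ZZnz ZZnz_mulC.

(* The multiplicative monoid of Z/d, for 1 < d; an alias is needed because
   the library already makes ['Z_d] an additive group. *)
Definition Zmodm (d : nat) : Type := 'Z_d.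
HB.instance Definition _ d := Choice.on (Zmodm d).
HB.instance Definition _ d := isMonoid.Build (Zmodm d)
  (@mulrA 'Z_d) (@mul1r 'Z_d) (@mulr1 'Z_d).

Definition resmod (d : nat) (m : nzint) : Zmodm d := (nzval m)%:~R : 'Z_d.

Definition phi_ (d : nat) : ZZnz -> monring (Zmodm d) := mr_map (resmod d).

Fact phi_is_zmod_morphism d : zmod_morphism (phi_ d).
Proof.
move=> a b; apply/eqP; rewrite -(inj_eq (addIr (phi_ d b))) subrK.
by rewrite /phi_ -mr_mapD subrK.
Qed.
HB.instance Definition _ d :=
  GRing.isZmodMorphism.Build ZZnz (monring (Zmodm d)) (phi_ d)
    (@phi_is_zmod_morphism d).

Fact phi_is_monoid_morphism d : monoid_morphism (phi_ d).
Proof.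
split; first by rewrite /phi_ mr_mapU.
by apply: mr_mapM => m n; rewrite /resmod rmorphM.
Qed.
HB.instance Definition _ d :=
  GRing.isMonoidMorphism.Build ZZnz (monring (Zmodm d)) (phi_ d)
    (@phi_is_monoid_morphism d).

Definition principal_ideal (A : comNzRingType) (t r : A) : Prop :=
  exists s, r = s * t.

Definition mr_congr (m : nat) (a b : ZZnz) : Prop :=
  exists2 s : seq (int * (nzint * nzint)),
    {in s, forall t, (nzval t.2.1 = nzval t.2.2 %[mod m])%Z} &
    a - b = \sum_(t <- s) (mr_of t.2.1 - mr_of t.2.2) *~ t.1.

(* The kernel of the reduction (Z/d)^* -> (Z/d1)^*, for 1 < d and d1 %| d. It
   is stated as a congruence because ['Z_1] is not the trivial ring. *)
Definition ker_units (d d1 : nat) : {set {unit 'Z_d}} :=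
  [set u : {unit 'Z_d} | (FinRing.uval u == 1 %[mod d1])%N].

Definition class_in (d : nat) (H : {set {unit 'Z_d}}) (h : nzint) : Prop :=
  exists2 u, u \in H & FinRing.uval u = (nzval h)%:~R.

Notation Qx := {fraction {poly rat}}.
Notation "p %:F" := (FracField.tofrac p) : ring_scope.

(* f(y), for y : Q(x); meaningful when no nonzero polynomial over Q vanishes at
   y, as is the case of y = x^m (m <> 0) and y = - x: see [frac_substE]. *)
Definition poly_subst (y : Qx) (p : {poly rat}) : Qx :=
  (map_poly (fun c : rat => (c%:P)%:F) p).[y].
Definition frac_subst (y f : Qx) : Qx :=
  poly_subst y \n_(generic_quotient.repr f)
    / poly_subst y \d_(generic_quotient.repr f).

Lemma poly_substM y : {morph poly_subst y : p q / p * q}.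
Proof.
move=> p q; rewrite /poly_subst.
rewrite (_ : (fun c => _) = (@FracField.tofrac {poly rat}) \o polyC) //.
by rewrite rmorphM hornerM.
Qed.

Lemma frac_numden (f : Qx) :
  f = (\n_(generic_quotient.repr f))%:F / (\d_(generic_quotient.repr f))%:F.
Proof.
have d0 := denom_ratioP (generic_quotient.repr f).
set n := \n_ _; set d := \d_ _ in d0 *.
have d0' : d%:F != 0 by rewrite tofrac_eq0.
apply: (mulIf d0'); rewrite divfK // -{1}[f]generic_quotient.reprK.
unlock FracField.tofrac; rewrite -[LHS]FracField.pi_mul.
apply/generic_quotient.eqmodP => /=; rewrite FracField.equivfE /FracField.mulf /=.
rewrite !numden_Ratio ?oner_eq0 ?mulr1 ?mulf_neq0 ?denom_ratioP //.
by rewrite mulrC.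
Qed.

Lemma frac_substE (y : Qx) (p q : {poly rat}) :
    (forall r : {poly rat}, r != 0 -> poly_subst y r != 0) -> q != 0 ->
  frac_subst y (p%:F / q%:F) = poly_subst y p / poly_subst y q.
Proof.
move=> Hy q0; have := denom_ratioP (generic_quotient.repr (p%:F / q%:F)).
have := frac_numden (p%:F / q%:F); rewrite /frac_subst.
set n := \n_ _; set e := \d_ _; move: n e => n e E e0; apply/eqP.
rewrite eqr_div ?Hy // -!poly_substM; apply/eqP; congr poly_subst; apply/eqP.
move/eqP: E; rewrite eqr_div ?tofrac_eq0 // -!tofracM tofrac_eq => /eqP pe.
by rewrite [p * e]pe mulrC.
Qed.

Definition mr_act (a : ZZnz) (f : Qx) : Qx :=
  \sum_(m <- mr_supp a) frac_subst ('X%:F ^ nzval m) f *~ mr_coef a m.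

Definition Ann (f : Qx) : {pred ZZnz} := [pred r | mr_act r f == 0].

Section Values.
Variable C : numClosedFieldType.

Definition poly_val (p : {poly rat}) (xi : C) : C := (map_poly ratr p).[xi].

Definition defined_at (F : Qx) (xi : C) : Prop :=
  exists P Q : {poly rat}, F = P%:F / Q%:F /\ poly_val Q xi != 0.

Definition has_value (F : Qx) (xi v : C) : Prop :=
  exists P Q : {poly rat},
    [/\ F = P%:F / Q%:F, poly_val Q xi != 0 & v = poly_val P xi / poly_val Q xi].

End Values.

Definition rat_Cyclotomic (d : nat) : {poly rat} := map_poly intr 'Phi_d.

Definition Cyclotomic_factor (d : nat) (F : Qx) : Prop :=
  exists P Q : {poly rat},
    [/\ F = P%:F / Q%:F, rat_Cyclotomic d %| P & ~~ (rat_Cyclotomic d %| Q)].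

(* Main.v *)
(** Fix a primitive [d]-th root of unity [zeta].  The function [a |-> f(zeta^a)],
    set to [0] where [f] has a pole, extends linearly to [Z[Z°]]; it only depends
    on [phi_d] and, since [f(1/x) = - f(x)], it kills the ideal of [[1] + [-1]].
    Hence hypothesis (2) says that [T(b) := (alpha1 f)(zeta^b)], for [b] prime to
    [d], only depends on [b] mod [d1].  As [(alpha f)(zeta) = \sum_b n_b T(b)] for
    [alpha2 = \sum_b n_b [b]], this sum vanishes when [alpha2 = 0 mod [d1]].

    For (b) one needs moreover [T(b + d/2) = T(b)], i.e. [F(-xi) = F(xi)] for
    [F = alpha1 f] and [xi = zeta^b].  With [G = alpha1 g], the identity
    [G(x) - G(-x) = 2 (F(x) - F(-x))] holds because only the odd elements of the
    support of [alpha1] contribute to either side.  Both [xi] and [-xi] are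
    Galois conjugate to [zeta], so [G] vanishes at both. *)
From HB Require Import structures.
Require Import Defs.
From mathcomp Require Import all_boot all_order all_fingroup all_algebra all_field.
From mathcomp Require Import finmap.
From mathcomp.multinomials Require Import monalg.
From mathcomp Require Import reals complex.
From mathcomp Require Import boolp classical_sets zify.

Set Implicit Arguments.
Unset Strict Implicit.
Unset Printing Implicit Defensive.

Import Order.TTheory GRing.Theory Num.Theory.
Local Open Scope ring_scope.

(** * Additive extension of a map on a monoid to its monoid ring *)

(** The action [mr_act] on [Qx] and the evaluation [mr_val] below are both instances. *)
Definition mr_lin (G : monoidType) (V : zmodType) (v : G -> V)
    (a : monring G) : V :=
  \sum_(m <- mr_supp a) v m *~ mr_coef a m.

Section LinearExtension.
Variables (G : monoidType) (V : zmodType).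
Implicit Types (v : G -> V) (a b : monring G).

Lemma mr_linD v : {morph mr_lin v : a b / a + b}.
Proof.
move=> a b; apply: (mr_sumD (F := fun m x => v m *~ x)) => [m|m x y].
  exact: mulr0z.
exact: mulrzDr.
Qed.

Lemma mr_lin_scaled v z m : mr_lin v (mr_scaled z m) = v m *~ z.
Proof. by apply: (mr_sumU (F := fun m x => v m *~ x)) => k; exact: mulr0z. Qed.

Lemma mr_lin_of v m : mr_lin v (mr_of m) = v m.
Proof. exact: mr_lin_scaled. Qed.

Lemma mr_lin0 v : mr_lin v 0 = 0.
Proof. by rewrite /mr_lin /mr_supp msupp0 big_seq_fset0. Qed.

HB.instance Definition _ v :=
  GRing.isNmodMorphism.Build (monring G) V (mr_lin v) (mr_lin0 v, mr_linD v).

Lemma eq_in_mr_lin v w a :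
  {in mr_supp a, v =1 w} -> mr_lin v a = mr_lin w a.
Proof. by move=> vw; apply: eq_big_seq => m /vw->. Qed.

Lemma mr_linM v a b :
  mr_lin v (a * b) = mr_lin (fun n => mr_lin (fun m => v (m * n)%g) a) b.
Proof.
rewrite {1}[b]mrE mulr_sumr raddf_sum; apply: eq_bigr => n _ /=.
rewrite {1}[a]mrE mulr_suml raddf_sum mulrz_suml; apply: eq_bigr => m _ /=.
by rewrite [_ * _]mr_mulUU mr_lin_scaled mulrzA.
Qed.

End LinearExtension.

Lemma mr_lin_map (G H : monoidType) (V : zmodType) (phi : G -> H) (v : H -> V)
    (a : monring G) :
  mr_lin v (mr_map phi a) = mr_lin (v \o phi) a.
Proof.
by rewrite /mr_map raddf_sum; apply: eq_bigr => m _ /=; rewrite mr_lin_scaled.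
Qed.

Lemma raddf_mr_lin (G : monoidType) (V W : zmodType) (h : {additive V -> W})
    (v : G -> V) (a : monring G) :
  h (mr_lin v a) = mr_lin (h \o v) a.
Proof. by rewrite raddf_sum; apply: eq_bigr => m _ /=; rewrite raddfMz. Qed.

(** It is the minimal polynomial [p] of a primitive root: if [p = r * q], one of [r], [q] vanishes
    at the root and so is divisible by [p]. *)
Lemma rat_Cyclotomic_irreducible d :
  (0 < d)%N -> irreducible_poly (rat_Cyclotomic d).
Proof.
move=> d_gt0; have [z zd] := C_prim_root_exists d_gt0.
have [p [Dp mon_p] dv_p] := minCpolyP z.
have pE : p = rat_Cyclotomic d.
  apply: (map_poly_inj (ratr : rat -> algC)).
  rewrite -Dp (minCpoly_cyclotomic zd) -(Cintr_Cyclotomic zd) /rat_Cyclotomic.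
  rewrite -map_poly_comp; apply: eq_map_poly => c; exact: (esym (ratr_int _ _)).
rewrite -pE; split.
  by rewrite -(size_map_poly (ratr : rat -> algC)) -Dp size_minCpoly.
move=> q q1 qp; rewrite /eqp qp /=; have /dvdpP[r rE] := qp.
have : root (map_poly (ratr : rat -> algC) p) z by rewrite dv_p dvdpp.
rewrite rE rmorphM rootM !dv_p => /orP[pr|]; last by rewrite -rE.
have p0 : p != 0 by exact: monic_neq0.
case/negP: q1.
have r0 : r != 0 by apply: contraNneq p0 => r0; rewrite rE r0 mul0r.
have q0 : q != 0 by apply: contraNneq p0 => q0; rewrite rE q0 mulr0.
(* When [p] divides [r], comparing sizes forces [q] to be constant. *)
have := dvdp_leq r0 pr; rewrite rE size_mul // => le.
have := size_poly_gt0 q; rewrite q0.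
by case: (size q) le => [|[|k]] //; rewrite !addnS /= ltnNge leq_addr.
Qed.

(** * Substitution into polynomials *)

Lemma poly_substD y : {morph poly_subst y : p q / p + q}.
Proof.
move=> p q; rewrite /poly_subst.
rewrite (_ : (fun c => _) = (@FracField.tofrac {poly rat}) \o polyC) //.
by rewrite rmorphD hornerD.
Qed.

Lemma poly_substC y c : poly_subst y c%:P = (c%:P)%:F.
Proof.
rewrite /poly_subst.
rewrite (_ : (fun c => _) = (@FracField.tofrac {poly rat}) \o polyC) //.
by rewrite map_polyC hornerC.
Qed.

Lemma poly_subst0 y : poly_subst y 0 = 0.
Proof. by rewrite -polyC0 poly_substC tofrac0. Qed.

Lemma poly_substX y : poly_subst y 'X = y.
Proof.
rewrite /poly_subst.
rewrite (_ : (fun c => _) = (@FracField.tofrac {poly rat}) \o polyC) //.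
by rewrite map_polyX hornerX.
Qed.

(** The condition under which [frac_subst y] may be computed on any fraction representing its
    argument, and hence is a field morphism. *)
Definition transcendental (y : Qx) : Prop :=
  forall p : {poly rat}, p != 0 -> poly_subst y p != 0.

(** * Values of polynomials and rational functions at points of [C] *)

Section Values.
Variable C : numClosedFieldType.
Implicit Types (xi v w : C) (p q : {poly rat}) (F f y : Qx).

Local Notation val p xi := (poly_val p xi).

Lemma poly_valD p q xi : val (p + q) xi = val p xi + val q xi.
Proof. by rewrite /poly_val rmorphD hornerD. Qed.

Lemma poly_valN p xi : val (- p) xi = - val p xi.
Proof. by rewrite /poly_val rmorphN hornerN. Qed.

Lemma poly_valM p q xi : val (p * q) xi = val p xi * val q xi.
Proof. by rewrite /poly_val rmorphM hornerM. Qed.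

Lemma poly_valC (c : rat) xi : val c%:P xi = ratr c.
Proof. by rewrite /poly_val map_polyC hornerC. Qed.

Lemma poly_val0 xi : val 0 xi = 0.
Proof. by rewrite -polyC0 poly_valC rmorph0. Qed.

Lemma poly_val1 xi : val 1 xi = 1.
Proof. by rewrite -polyC1 poly_valC rmorph1. Qed.

Lemma poly_valX xi : val 'X xi = xi.
Proof. by rewrite /poly_val map_polyX hornerX. Qed.

Lemma poly_val_tofrac_neq0 p xi : val p xi != 0 -> p%:F != 0 :> Qx.
Proof.
by apply: contraNneq => /eqP; rewrite tofrac_eq0 => /eqP->; rewrite poly_val0.
Qed.

(** Some ['Phi_k] with [k] dividing [d] vanishes at [z], since their product is [X^d - 1]. Then
    [z ^ k = 1], and the order of [z] forces [k = d]. *)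
Lemma root_rat_Cyclotomic d (z : C) :
  (0 < d)%N -> d.-primitive_root z -> val (rat_Cyclotomic d) z = 0.
Proof.
move=> d_gt0 zd.
have rootE (p : {poly int}) :
    val (map_poly intr p) z = (map_poly (intr : int -> C) p).[z].
  rewrite /poly_val -map_poly_comp; congr (_.[z]).
  by apply: eq_map_poly => c /=; exact: ratr_int.
have Xn1 e : (0 < e)%N ->
    \prod_(k <- divisors e) (map_poly (intr : int -> C) 'Phi_k).[z] = z ^+ e - 1.
  move=> e_gt0; rewrite -horner_prod -rmorph_prod prod_Cyclotomic //=.
  by rewrite rmorphB rmorph1 /= map_polyXn !hornerE.
rewrite /rat_Cyclotomic rootE; apply/eqP.
have : \prod_(k <- divisors d) (map_poly (intr : int -> C) 'Phi_k).[z] == 0.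
  by rewrite Xn1 // prim_expr_order // subrr.
rewrite prodf_seq_eq0 => /hasP[k]; rewrite -dvdn_divisors // => kd /= kz.
suff -> : d = k by [].
apply/eqP; rewrite eqn_dvd kd andbT (prim_order_dvd zd) -subr_eq0.
rewrite -Xn1 ?(dvdn_gt0 d_gt0) // prodf_seq_eq0.
by apply/hasP; exists k; rewrite // -dvdn_divisors ?(dvdn_gt0 d_gt0).
Qed.

(** By irreducibility, a [p] not divisible by [rat_Cyclotomic d] is coprime to it, and a Bezout
    relation evaluated at [z] gives [p(z) != 0]. As the divisibility does not involve [z], this
    serves as Galois conjugacy of primitive roots. *)
Lemma poly_val_prim_root d (z : C) p : (0 < d)%N -> d.-primitive_root z ->
  (val p z == 0) = (rat_Cyclotomic d %| p).
Proof.
move=> d_gt0 zd; apply/eqP/idP => [pz|/dvdpP[q ->]]; last first.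
  by rewrite poly_valM (root_rat_Cyclotomic d_gt0 zd) mulr0.
have irr := rat_Cyclotomic_irreducible d_gt0.
apply/negPn/negP => Np.
have /Bezout_eq1_coprimepP : coprimep (rat_Cyclotomic d) p.
  rewrite coprimep_def; apply: contraNT Np => /irr/(_ (dvdp_gcdl _ _)) eq_gcd.
  by rewrite -(eqp_dvdl _ eq_gcd) dvdp_gcdr.
case=> -[u v] /= uv; have : val 1 z = 0.
  rewrite -uv poly_valD !poly_valM pz.
  by rewrite (root_rat_Cyclotomic d_gt0 zd) !mulr0 addr0.
by rewrite poly_val1 => /eqP; rewrite oner_eq0.
Qed.


Lemma has_value_uniq F xi v w : has_value F xi v -> has_value F xi w -> v = w.
Proof.
move=> [P [Q [-> Q0 ->]]] [P' [Q' [E Q'0 ->]]]; apply/eqP.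
have Qz := poly_val_tofrac_neq0 Q0; have Q'z := poly_val_tofrac_neq0 Q'0.
move/eqP: E; rewrite (eqr_div _ _ Qz Q'z) -!tofracM tofrac_eq => /eqP E.
by rewrite (eqr_div _ _ Q0 Q'0) -!poly_valM E.
Qed.

Lemma has_value_tofrac p xi : has_value p%:F xi (val p xi).
Proof.
by exists p, 1; rewrite poly_val1 tofrac1 !divr1 oner_neq0.
Qed.

Lemma has_valueD F f xi v w :
  has_value F xi v -> has_value f xi w -> has_value (F + f) xi (v + w).
Proof.
move=> [P [Q [-> Q0 ->]]] [P' [Q' [-> Q'0 ->]]].
exists (P * Q' + P' * Q), (Q * Q').
rewrite poly_valD !poly_valM mulf_neq0 //.
rewrite (addf_div _ _ (poly_val_tofrac_neq0 Q0) (poly_val_tofrac_neq0 Q'0)).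
by rewrite addf_div // tofracD !tofracM.
Qed.

Lemma has_valueM F f xi v w :
  has_value F xi v -> has_value f xi w -> has_value (F * f) xi (v * w).
Proof.
move=> [P [Q [-> Q0 ->]]] [P' [Q' [-> Q'0 ->]]].
by exists (P * P'), (Q * Q'); rewrite !poly_valM mulf_neq0 // !mulf_div !tofracM.
Qed.

Lemma has_valueV F xi v :
  v != 0 -> has_value F xi v -> has_value F^-1 xi v^-1.
Proof.
move=> v0 [P [Q [-> Q0 vE]]]; exists Q, P; rewrite vE !invf_div; split=> //.
by apply: contraNneq v0; rewrite vE => ->; rewrite mul0r.
Qed.

Lemma has_valueN F xi v : has_value F xi v -> has_value (- F) xi (- v).
Proof.
move=> Fv; rewrite -[F]mul1r -[v]mul1r -!mulNr; apply: has_valueM => //.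
have := has_value_tofrac (- 1) xi.
by rewrite poly_valN poly_val1 tofracN tofrac1.
Qed.

Lemma has_valueB F f xi v w :
  has_value F xi v -> has_value f xi w -> has_value (F - f) xi (v - w).
Proof. by move=> Fv /has_valueN; exact: has_valueD. Qed.

Lemma has_value0 xi : has_value 0 xi 0.
Proof. by have := has_value_tofrac 0 xi; rewrite poly_val0 tofrac0. Qed.

Lemma has_valueX xi : has_value 'X%:F xi xi.
Proof. by have := has_value_tofrac 'X xi; rewrite poly_valX. Qed.

Lemma has_valueXn F xi v (n : nat) :
  has_value F xi v -> has_value (F ^+ n) xi (v ^+ n).
Proof.
move=> Fv; elim: n => [|n IHn]; last by rewrite !exprS; exact: has_valueM.
by have := has_value_tofrac 1 xi; rewrite poly_val1 tofrac1.
Qed.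

Lemma has_valueXz F xi v (n : int) :
  v != 0 -> has_value F xi v -> has_value (F ^ n) xi (v ^ n).
Proof.
move=> v0 Fv; case: n => n; first exact: has_valueXn.
by apply: has_valueV; [rewrite expf_neq0|exact: has_valueXn].
Qed.

Lemma has_valueMz F xi v (n : int) :
  has_value F xi v -> has_value (F *~ n) xi (v *~ n).
Proof.
have Mn (k : nat) : has_value F xi v -> has_value (F *+ k) xi (v *+ k).
  move=> Fv; elim: k => [|k IHk]; first exact: has_value0.
  by rewrite !mulrS; exact: has_valueD.
by case: n => n Fv; [exact: Mn | apply/has_valueN/Mn].
Qed.

Lemma has_value_mr_lin (G : monoidType) (F : G -> Qx) (v : G -> C)
    (a : monring G) xi :
  (forall m, m \in mr_supp a -> has_value (F m) xi (v m)) ->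
  has_value (mr_lin F a) xi (mr_lin v a).
Proof.
move=> Fv; rewrite /mr_lin big_seq [X in has_value _ _ X]big_seq.
elim/big_ind2: _ => [|x v1 y v2|m ma].
- exact: has_value0.
- exact: has_valueD.
- exact/has_valueMz/Fv.
Qed.

Lemma has_value_poly_subst y p xi v :
  has_value y xi v -> has_value (poly_subst y p) xi (val p v).
Proof.
move=> yv; elim/poly_ind: p => [|p c IHp].
  by rewrite poly_subst0 poly_val0; exact: has_value0.
rewrite poly_substD poly_substM poly_substX poly_substC.
rewrite poly_valD poly_valM poly_valX poly_valC.
apply: has_valueD; first exact: has_valueM.
by have := has_value_tofrac c%:P xi; rewrite poly_valC.
Qed.

Lemma has_value_subst y F xi v w : transcendental y ->
  has_value y xi v -> has_value F v w -> has_value (frac_subst y F) xi w.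
Proof.
move=> yT yv [P [Q [-> Q0 ->]]].
have Qnz : Q != 0 by apply: contraNneq Q0 => ->; rewrite poly_val0.
rewrite frac_substE //.
apply: has_valueM; first exact: has_value_poly_subst.
by apply: has_valueV => //; exact: has_value_poly_subst.
Qed.

(* If [p] vanishes at [y], it has the infinitely many roots [v n]. *)
Lemma transcendental_values y (x v : nat -> C) :
  injective v -> (forall n, has_value y (x n) (v n)) -> transcendental y.
Proof.
move=> v_inj yv p p0; apply: contraTneq isT => p_y.
pose s := map v (iota 0 (size p)).
have := @max_poly_roots C (map_poly ratr p) s.
rewrite map_poly_eq0 map_inj_uniq // iota_uniq size_map size_iota size_map_poly.
rewrite ltnn => /(_ p0) lt_pp.
have/lt_pp/(_ isT) // : all (root (map_poly (ratr : rat -> C) p)) s.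
apply/allP => _ /mapP[n _ ->].
apply/rootP/(@has_value_uniq 0 (x n)); last exact: has_value0.
by rewrite -p_y; exact: has_value_poly_subst.
Qed.

End Values.

(** * Substitution as an endomorphism of [Q(x)] *)

(** At the points [2 ^ k], the function [x ^ n] takes pairwise distinct values. *)
Lemma transcendental_Xz (n : int) : n != 0 -> transcendental ('X%:F ^ n).
Proof.
move=> n0; have [q q0 q1] : exists2 q : rat, 0 < q & q != 1.
  by exists 2%:R; rewrite ?ltr0n // (eqr_nat _ 2 1).
have qz : ratr q != 0 :> algC by rewrite fmorph_eq0 gt_eqF.
apply: (@transcendental_values algC _ (fun k => ratr q ^+ k)
  (fun k => (ratr q ^+ k) ^ n)) => [k l /= | k]; last first.
  by apply: has_valueXz; [rewrite expf_neq0 | exact: has_valueX].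
rewrite !exprnP !exprz_exp -!fmorphXz => /fmorph_inj /(ieexprIz q0 q1).
by move=> /(mulIf n0) [].
Qed.

Lemma transcendental_NX : transcendental (- 'X%:F).
Proof.
apply: (@transcendental_values algC _ (fun k => k%:R) (fun k => - k%:R)).
  by move=> k l /oppr_inj/eqP; rewrite eqr_nat => /eqP.
by move=> k; exact/has_valueN/has_valueX.
Qed.

Lemma frac_ratio F : exists P Q : {poly rat}, Q != 0 /\ F = P%:F / Q%:F.
Proof.
do 2!eexists; split; last exact: frac_numden.
exact: denom_ratioP.
Qed.

Section Substitution.
Variable y : Qx.
Hypothesis yT : transcendental y.
Implicit Types F : Qx.

Lemma frac_subst_tofrac p : frac_subst y p%:F = poly_subst y p.
Proof.
rewrite -[p%:F]divr1 -tofrac1 frac_substE ?oner_eq0 //.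
by rewrite -polyC1 poly_substC tofrac1 divr1.
Qed.

Lemma frac_substM : {morph frac_subst y : F G / F * G}.
Proof.
move=> F G; have [P [Q [Q0 ->]]] := frac_ratio F.
have [P' [Q' [Q'0 ->]]] := frac_ratio G.
by rewrite mulf_div -!tofracM !frac_substE ?mulf_neq0 // !poly_substM mulf_div.
Qed.

Lemma frac_substD : {morph frac_subst y : F G / F + G}.
Proof.
move=> F G; have [P [Q [Q0 ->]]] := frac_ratio F.
have [P' [Q' [Q'0 ->]]] := frac_ratio G.
rewrite addf_div ?tofrac_eq0 // -!tofracM -tofracD !frac_substE ?mulf_neq0 //.
by rewrite poly_substD !poly_substM addf_div ?yT.
Qed.

Lemma frac_subst0 : frac_subst y 0 = 0.
Proof. by rewrite -tofrac0 frac_subst_tofrac poly_subst0. Qed.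

Lemma frac_subst1 : frac_subst y 1 = 1.
Proof. by rewrite -tofrac1 frac_subst_tofrac -polyC1 poly_substC tofrac1. Qed.

Fact frac_subst_zmod_morphism : zmod_morphism (frac_subst y).
Proof.
move=> F G; apply: (addIr (frac_subst y G)).
by rewrite -frac_substD !subrK.
Qed.

Definition frac_subst_rmorphism : {rmorphism Qx -> Qx} :=
  HB.pack (frac_subst y)
    (GRing.isZmodMorphism.Build Qx Qx (frac_subst y) frac_subst_zmod_morphism)
    (GRing.isMonoidMorphism.Build Qx Qx (frac_subst y) (frac_subst1, frac_substM)).

Lemma frac_substB : {morph frac_subst y : F G / F - G}.
Proof. exact: frac_subst_zmod_morphism. Qed.

Lemma frac_subst_div : {morph frac_subst y : F G / F / G}.
Proof. exact: (fmorph_div frac_subst_rmorphism). Qed.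

Lemma frac_subst_poly (u : Qx) p :
  frac_subst y (poly_subst u p) = poly_subst (frac_subst y u) p.
Proof.
elim/poly_ind: p => [|p c IHp]; first by rewrite !poly_subst0 frac_subst0.
rewrite !(poly_substD, poly_substM, poly_substX, poly_substC).
by rewrite frac_substD frac_substM IHp frac_subst_tofrac poly_substC.
Qed.

(** Substituting [y] is a field morphism, hence injective, so it keeps [poly_subst u p] nonzero. *)
Lemma transcendental_subst u :
  transcendental u -> transcendental (frac_subst y u).
Proof.
move=> uT p p0; rewrite -frac_subst_poly.
by rewrite (fmorph_eq0 frac_subst_rmorphism) uT.
Qed.

Lemma frac_subst_comp u F : transcendental u ->
  frac_subst y (frac_subst u F) = frac_subst (frac_subst y u) F.
Proof.
move=> uT; have [P [Q [Q0 ->]]] := frac_ratio F.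
rewrite (frac_substE _ uT Q0) (frac_substE _ (transcendental_subst uT) Q0).
by rewrite frac_subst_div !frac_subst_poly.
Qed.

Lemma frac_substX : frac_subst y 'X%:F = y.
Proof. by rewrite frac_subst_tofrac poly_substX. Qed.

Lemma frac_subst_mr_lin (G : monoidType) (v : G -> Qx) (a : monring G) :
  frac_subst y (mr_lin v a) = mr_lin (fun m => frac_subst y (v m)) a.
Proof. exact: (raddf_mr_lin frac_subst_rmorphism). Qed.

Lemma frac_substXz F (n : int) : frac_subst y (F ^ n) = frac_subst y F ^ n.
Proof. exact: (fmorphXz frac_subst_rmorphism). Qed.

Lemma frac_substN F : frac_subst y (- F) = - frac_subst y F.
Proof. exact: (rmorphN frac_subst_rmorphism). Qed.

End Substitution.

Lemma frac_substX_id F : frac_subst 'X%:F F = F.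
Proof.
have XT : transcendental 'X%:F by exact: (@transcendental_Xz 1).
have [P [Q [Q0 ->]]] := frac_ratio F; rewrite frac_substE //.
suff poly_substXE p : poly_subst 'X%:F p = p%:F by rewrite !poly_substXE.
elim/poly_ind: p => [|p c IHp]; first by rewrite poly_subst0 tofrac0.
by rewrite poly_substD poly_substM poly_substX poly_substC IHp tofracD tofracM.
Qed.

(** * Integer exponents modulo [d] and primitive roots of unity *)

Section IntegerResidues.
Variable d : nat.
Hypothesis d_gt1 : (1 < d)%N.

Lemma Zp_intE (a : int) : ((a%:~R : 'Z_d) : nat)%:Z = (a %% d)%Z.
Proof.
have d0 : d != 0 :> int by rewrite eqz_nat -lt0n ltnW.
have : (0 <= (a %% d)%Z)%R by exact: modz_ge0.
have : (a %% d < d)%Z by apply: ltz_pmod; exact: ltnW d_gt1.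
have -> : (a%:~R : 'Z_d) = (a %% d)%Z%:~R.
  rewrite {1}(divz_eq a d) rmorphD rmorphM /=.
  by rewrite -[d%:~R]/(d%:R) pchar_Zp // mulr0 add0r.
case: (a %% d)%Z => // r lt_rd _.
by rewrite -[r%:~R]/(r%:R) val_Zp_nat // modn_small.
Qed.

Lemma Zp_int_eq (a b : int) :
  (a%:~R == b%:~R :> 'Z_d) = (a == b %[mod d])%Z.
Proof. by rewrite -!Zp_intE. Qed.

Lemma exprz_Zp (F : fieldType) (x : F) (a : int) :
  x ^+ d = 1 -> x ^ a = x ^+ ((a%:~R : 'Z_d) : nat).
Proof.
move=> xd; have x0 : x != 0.
  apply: contra_eq_neq xd => ->.
  by rewrite expr0n gtn_eqF ?(ltnW d_gt1) // eq_sym oner_eq0.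
rewrite exprnP Zp_intE {1}(divz_eq a d) expfzDr // [(a %/ d)%Z * _]mulrC -exprz_exp.
by rewrite -[x ^ d]/(x ^+ d) xd exp1rz mul1r.
Qed.

End IntegerResidues.

Lemma prim_root_neq0 (F : fieldType) (d : nat) (z : F) :
  d.-primitive_root z -> z != 0.
Proof.
move=> zd; apply: contra_eq_neq (prim_expr_order zd) => ->.
by rewrite expr0n gtn_eqF ?(prim_order_gt0 zd) // eq_sym oner_eq0.
Qed.

Lemma prim_root_exprz (F : fieldType) (d : nat) (z : F) (b : int) :
  (1 < d)%N -> d.-primitive_root z -> coprimez b d -> d.-primitive_root (z ^ b).
Proof.
move=> d_gt1 zd bd; rewrite (exprz_Zp d_gt1 _ (prim_expr_order zd)).
rewrite prim_root_exp_coprime //.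
by move: bd; rewrite /coprimez -gcdz_modl -(Zp_intE d_gt1).
Qed.

(** * Evaluation on the monoid ring, with value [0] at poles *)

Section Values.
Variable C : numClosedFieldType.
Implicit Types (F f : Qx) (xi v : C).

(** The ideal elements in hypothesis (2) may involve powers of the root where [f] has a pole, so a
    total function is needed. The default [0] is its own opposite, which lets [xval_inv] hold at
    poles too. *)
Definition xval F xi : C := xget 0 [set v | has_value F xi v]%classic.

Lemma xvalE F xi v : has_value F xi v -> xval F xi = v.
Proof. by move=> Fv; apply: xget_unique => // w /has_value_uniq/(_ Fv). Qed.

Lemma xvalP F xi : defined_at F xi -> has_value F xi (xval F xi).
Proof.
move=> [P [Q [-> Q0]]]; apply: (@xgetI _ _ [set v | has_value _ xi v]%classic).
by exists P, Q; split.
Qed.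

(** Annihilation by [[1] + [-1]] says [f(x) = - f(1/x)]. *)
Lemma has_value_inv f xi v : mr_of nz_one + mr_of nz_mone \in Ann f ->
  xi != 0 -> has_value f xi v -> has_value f xi^-1 (- v).
Proof.
rewrite inE -[mr_act _ f]/(mr_lin _ _) raddfD /= !mr_lin_of expr1z exprN1.
rewrite frac_substX_id addr_eq0 => /eqP {2}-> xi0 fv; apply: has_valueN.
apply: has_value_subst fv; first exact: (@transcendental_Xz (-1)).
by rewrite -[X in has_value _ _ X]invrK; apply/has_valueV/has_valueX/invr_neq0.
Qed.

Lemma xval_inv f xi : mr_of nz_one + mr_of nz_mone \in Ann f ->
  xi != 0 -> xval f xi^-1 = - xval f xi.
Proof.
move=> fA xi0; rewrite {2}/xval; case: xgetP => [v _ fv|Nf].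
  exact/xvalE/has_value_inv.
(* If [f] has no value at [xi] it has none at [xi^-1] either, inversion being an involution; both
   sides are then the default. *)
rewrite oppr0; apply: xgetPN => v /(has_value_inv fA); rewrite invr_eq0 invrK.
by move=> /(_ xi0); exact: Nf.
Qed.

Definition mr_val f xi (a : ZZnz) : C := mr_lin (fun m => xval f (xi ^ nzval m)) a.

(** For [a := alpha1], [b := alpha2] and [xi := zeta], the function extended on the right is the [T]
    of the overview. *)
Lemma mr_valM f xi a b :
  mr_val f xi (a * b) = mr_lin (fun n : nzint => mr_val f (xi ^ nzval n) a) b.
Proof.
rewrite /mr_val mr_linM; congr mr_lin; apply/funext => n.
by congr mr_lin; apply/funext => m; rewrite exprz_exp mulrC.
Qed.

(** As [xi ^ d = 1], the power [xi ^ m] depends only on [m] mod [d], so the evaluation factors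
    through [phi_ d]. *)
Lemma mr_val_phi d f xi a b : (1 < d)%N -> xi ^+ d = 1 ->
  phi_ d a = phi_ d b -> mr_val f xi a = mr_val f xi b.
Proof.
move=> d_gt1 xid; pose v (k : Zmodm d) := xval f (xi ^+ (k : 'Z_d)).
have valE c : mr_val f xi c = mr_lin v (phi_ d c).
  rewrite mr_lin_map; congr mr_lin; apply/funext => m.
  by rewrite /v /= -exprz_Zp.
by rewrite !valE => ->.
Qed.

(** Each [n] in the cofactor [s] contributes a multiple of [f(xi^n) + f(xi^-n)], which is [0], even
    at poles. *)
Lemma mr_val_ideal f xi a : mr_of nz_one + mr_of nz_mone \in Ann f -> xi != 0 ->
  principal_ideal (mr_of nz_one + mr_of nz_mone) a -> mr_val f xi a = 0.
Proof.
move=> fA xi0 [s ->]; rewrite mulrC mr_valM.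
rewrite (_ : (fun n => _) = fun=> 0) ?/mr_lin ?big1 // => [m _|].
  by rewrite mul0rz.
apply/funext => n; rewrite /mr_val raddfD /= !mr_lin_of.
by rewrite expr1z exprN1 xval_inv ?subrr // expfz_neq0.
Qed.

Lemma has_value_act f xi a :
  xi != 0 -> (forall m, m \in mr_supp a -> defined_at f (xi ^ nzval m)) ->
  has_value (mr_act a f) xi (mr_val f xi a).
Proof.
move=> xi0 f_def; apply: has_value_mr_lin => m /f_def/xvalP.
apply: has_value_subst; first exact/transcendental_Xz/nzvalP.
exact/has_valueXz/has_valueX.
Qed.

(** Expanding the product first avoids describing the support of [a * b], where cancellation may
    occur. *)
Lemma has_value_actM f xi a b :
  xi != 0 ->
  (forall m n, m \in mr_supp a -> n \in mr_supp b ->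
     defined_at f ((xi ^ nzval n) ^ nzval m)) ->
  has_value (mr_act (a * b) f) xi (mr_val f xi (a * b)).
Proof.
move=> xi0 f_def; rewrite -[mr_act _ _]/(mr_lin _ _) mr_linM /mr_val mr_linM.
apply: has_value_mr_lin => n nb; apply: has_value_mr_lin => m ma.
have := xvalP (f_def m n ma nb); rewrite exprz_exp [X in xi ^ X]mulrC.
apply: has_value_subst; first exact/transcendental_Xz/nzvalP.
exact/has_valueXz/has_valueX.
Qed.

Lemma Cyclotomic_factor_value d (z : C) F : (0 < d)%N -> d.-primitive_root z ->
  has_value F z 0 -> Cyclotomic_factor d F.
Proof.
move=> d_gt0 zd [P [Q [-> Q0 /esym/eqP Pz]]]; exists P, Q; split=> //.
  rewrite -(poly_val_prim_root _ d_gt0 zd).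
  by move: Pz; rewrite mulf_eq0 invr_eq0 (negPf Q0) orbF.
by rewrite -(poly_val_prim_root _ d_gt0 zd).
Qed.

Lemma has_value0_conj d (z z' : C) F : (0 < d)%N ->
  d.-primitive_root z -> d.-primitive_root z' ->
  has_value F z 0 -> has_value F z' 0.
Proof.
move=> d_gt0 zd z'd [P [Q [-> Q0 /esym/eqP Pz]]]; exists P, Q.
move: Q0 Pz; rewrite mulf_eq0 invr_eq0 => Q0; rewrite (negPf Q0) orbF.
rewrite (poly_val_prim_root _ d_gt0 zd) -(poly_val_prim_root _ d_gt0 z'd) => /eqP->.
by rewrite mul0r (poly_val_prim_root _ d_gt0 z'd) -(poly_val_prim_root _ d_gt0 zd).
Qed.

Lemma defined_at_conj d (z : C) f (a b : int) : (1 < d)%N ->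
  d.-primitive_root z -> coprimez b d ->
  defined_at f (z ^ a) -> defined_at f ((z ^ b) ^ a).
Proof.
move=> d_gt1 zd bd; have zbd := prim_root_exprz d_gt1 zd bd.
rewrite !(exprz_Zp d_gt1 a (prim_expr_order _)) //.
move: (nat_of_ord _) => k [P [Q [-> Q0]]]; exists P, Q; split=> //.
(* Both powers are primitive roots of the same order [d / gcd(k, d)], so they are zeros of the same
   denominators. *)
have zk := exp_prim_root zd k; have zbk := exp_prim_root zbd k.
have e_gt0 := prim_order_gt0 zk.
by rewrite (poly_val_prim_root _ e_gt0 zbk) -(poly_val_prim_root _ e_gt0 zk).
Qed.

End Values.

(** * Vanishing from a congruence, and the reflection [x -> -x] *)

Lemma mr_lin_congr0 (V : zmodType) (v : nzint -> V) (P : nzint -> Prop)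
    (D : nat) (a : ZZnz) :
  (forall m, m \in mr_supp a -> P m) ->
  (forall m n, P m -> P n -> (nzval m = nzval n %[mod D])%Z -> v m = v n) ->
  mr_congr D a 0 -> mr_lin v a = 0.
Proof.
(* [v] agrees on [P] with a function [w] defined on residue classes mod [D]. *)
move=> aP vP [s sD]; rewrite subr0 => aE.
pose cls m := [set n | P n /\ (nzval n = nzval m %[mod D])%Z]%classic.
pose w m := v (xget nz_one (cls m)).
rewrite (@eq_in_mr_lin _ _ _ w) => [|m /aP Pm]; last first.
  have [Pn nm] : cls m (xget nz_one (cls m)) by apply: (@xgetI _ _ _ m).
  exact/esym/vP.
rewrite aE raddf_sum big_seq big1 // => t /sD tD.
(* The two members of [t] may fail [P], where [v] is not controlled; but [w] agrees on them, since
   they have the same class. *)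
rewrite raddfMz raddfB /= !mr_lin_of /w (_ : cls t.2.1 = cls t.2.2) ?subrr ?mul0rz //.
by rewrite /cls tD.
Qed.

Lemma mr_lin_funB (G : monoidType) (V : zmodType) (v w : G -> V) (a : monring G) :
  mr_lin (fun m => v m - w m) a = mr_lin v a - mr_lin w a.
Proof. by rewrite /mr_lin -sumrB; apply: eq_bigr => m _; rewrite mulrzBl. Qed.

Lemma exprNz (F : fieldType) (x : F) (n : int) :
  (- x) ^ n = if odd `|n| then - x ^ n else x ^ n.
Proof.
have NXn k : (- x) ^+ k = if odd k then - x ^+ k else x ^+ k.
  by rewrite exprNn -signr_odd; case: odd; rewrite ?expr1 ?mulN1r ?mul1r.
case: n => n; first exact: NXn.
rewrite /= /exprz NXn /=; case: odd => //=.
by rewrite invrN.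
Qed.

(* [G(x) - G(-x) = 2 (F(x) - F(-x))], arranged so as to use subtractions only. *)
Lemma act_reflection f g (a : ZZnz) : g = f - frac_subst (- 'X%:F) f ->
  let F := mr_act a f in let G := mr_act a g in
  G - frac_subst (- 'X%:F) G - (F - frac_subst (- 'X%:F) F) =
    F - frac_subst (- 'X%:F) F.
Proof.
move=> gE F G; rewrite {}/F {}/G; have NT := transcendental_NX.
rewrite -![mr_act a _]/(mr_lin _ a) !(frac_subst_mr_lin NT) -!mr_lin_funB.
congr mr_lin; apply/funext => m /=; set x := 'X%:F ^ nzval m.
have xT : transcendental x by exact/transcendental_Xz/nzvalP.
have NxE : frac_subst x (- 'X%:F) = - x by rewrite frac_substN // frac_substX.
have NxT : transcendental (- x) by rewrite -NxE; exact: transcendental_subst.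
have hx : frac_subst (- 'X%:F) x = (- 'X%:F) ^ nzval m.
  by rewrite frac_substXz // frac_substX.
rewrite gE (frac_substB xT) (frac_subst_comp xT _ NT) NxE (frac_substB NT).
rewrite (frac_subst_comp NT _ xT) (frac_subst_comp NT _ NxT) (frac_substN NT) hx.
(* Even exponents contribute [0] to both sides. For odd ones, with [A = f(x^m)] and [B = f(-x^m)],
   the claim is [((A - B) - (B - A)) - (A - B) = A - B]. *)
rewrite exprNz -/x; case: odd; last by rewrite !subrr.
set A := frac_subst x f; set B := frac_subst (- x) f.
by rewrite opprK -[B - A]opprB opprK addrK.
Qed.

(** * Values of [alpha1 f] at the primitive roots [zeta ^ b] *)

Section Main.
Variables (C : numClosedFieldType) (d d1 : nat) (zeta : C) (f : Qx).
Variable alpha1 : ZZnz.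
Hypotheses (d_gt1 : (1 < d)%N) (d1_dvd : (d1 %| d)%N).
Hypothesis zeta_prim : d.-primitive_root zeta.
Hypothesis f_ann : mr_of nz_one + mr_of nz_mone \in Ann f.
Hypothesis f_def : forall a : nzint, a \in mr_supp alpha1 ->
  defined_at f (zeta ^ nzval a).

Let d_gt0 : (0 < d)%N := ltnW d_gt1.

Let zeta_neq0 : zeta != 0.
Proof. exact: prim_root_neq0 zeta_prim. Qed.

(** Take [h = c / b] modulo [d], which lies in the kernel. Evaluating [([h] - [1]) alpha1] at
    [zeta ^ b] gives the value of [alpha1 f] at [zeta ^ (h b) = zeta ^ c] minus that at [zeta ^ b],
    and hypothesis (2) makes it [0]. *)
Lemma mr_val_unit_congr (b c : int) :
    (forall h : nzint, class_in (ker_units d d1) h ->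
       exists2 r : ZZnz, principal_ideal (mr_of nz_one + mr_of nz_mone) r &
         phi_ d ((mr_of h - mr_of nz_one) * alpha1) = phi_ d r) ->
    coprimez b d -> coprimez c d -> (b = c %[mod d1])%Z ->
  mr_val f (zeta ^ b) alpha1 = mr_val f (zeta ^ c) alpha1.
Proof.
move=> alpha1_inv bd cd bc.
have unitE (e : int) : coprimez e d -> (e%:~R : 'Z_d) \is a GRing.unit.
  move=> ed; rewrite -[e%:~R]natr_Zp unitZpE //.
  by move: ed; rewrite coprime_sym /coprimez -gcdz_modl -(Zp_intE d_gt1).
have [k k_unit kb] : exists2 k : 'Z_d, k \is a GRing.unit & k * b%:~R = c%:~R.
  by exists (c%:~R / b%:~R); rewrite ?divrK // ?unitrM ?unitrV !unitE.
have k0 : (nat_of_ord k)%:Z != 0.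
  apply: contraTneq k_unit => -[k0]; rewrite (_ : k = 0) ?unitr0 //.
  exact: val_inj.
pose h := NZInt k0.
have hE : (nzval h)%:~R = k by rewrite -[RHS]natr_Zp.
have hb : ((nzval h * b)%:~R : 'Z_d) = c%:~R.
  by rewrite rmorphM /= hE.
have h_in : class_in (ker_units d d1) h.
  exists (FinRing.unit 'Z_d k_unit); rewrite ?hE // inE /=.
  have d1_d : (d1%:Z %| d%:Z)%Z by rewrite dvdzE.
  have d1b : coprimez d1 b.
    by rewrite coprimez_sym; exact: coprimez_dvdr d1_dvd bd.
  (* Since [b] is invertible mod [d1], [h = 1] follows from [h b = c = b] mod [d1]. *)
  rewrite -eqz_nat -!modz_nat eqz_mod_dvd -(Gauss_dvdzl _ d1b) mulrBl mul1r.
  rewrite -eqz_mod_dvd bc eqz_mod_dvd; apply: (dvdz_trans d1_d).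
by rewrite -eqz_mod_dvd -Zp_int_eq //; exact/eqP.
have [r r_ideal rE] := alpha1_inv _ h_in.
have zb0 : zeta ^ b != 0 by exact: expfz_neq0.
have zbd : (zeta ^ b) ^+ d = 1.
  by rewrite exprnP exprzAC -exprnP (prim_expr_order zeta_prim) exp1rz.
have := mr_val_phi f d_gt1 zbd rE; rewrite (mr_val_ideal f_ann zb0 r_ideal).
rewrite mulrC mr_valM raddfB /= !mr_lin_of expr1z => /eqP; rewrite subr_eq0 => /eqP <-.
congr mr_val; rewrite exprz_exp mulrC.
by rewrite !(exprz_Zp d_gt1 _ (prim_expr_order zeta_prim)) hb.
Qed.

(** The common end of both parts: [D] is [d1] in (a) and [d1 / 2] in (b). *)
Lemma Cyclotomic_factor_act (D : nat) (alpha2 : ZZnz) :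
    (forall a : nzint, a \in mr_supp alpha2 -> coprimez (nzval a) d) ->
    (forall b c : nzint, coprimez (nzval b) d -> coprimez (nzval c) d ->
       (nzval b = nzval c %[mod D])%Z ->
       mr_val f (zeta ^ nzval b) alpha1 = mr_val f (zeta ^ nzval c) alpha1) ->
  mr_congr D alpha2 0 -> Cyclotomic_factor d (mr_act (alpha1 * alpha2) f).
Proof.
move=> cop_alpha2 valD alpha2_0; apply: (Cyclotomic_factor_value d_gt0 zeta_prim).
suff <- : mr_val f zeta (alpha1 * alpha2) = 0.
  apply: has_value_actM => // m n /f_def fm /cop_alpha2 nd.
  exact: (defined_at_conj d_gt1 zeta_prim nd fm).
by rewrite mr_valM; apply: mr_lin_congr0 alpha2_0; [exact: cop_alpha2|exact: valD].
Qed.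

Lemma mr_val_opp g (b c : int) : g = f - frac_subst (- 'X%:F) f ->
    has_value (mr_act alpha1 g) zeta 0 ->
    coprimez b d -> coprimez c d -> zeta ^ c = - zeta ^ b ->
  mr_val f (zeta ^ b) alpha1 = mr_val f (zeta ^ c) alpha1.
Proof.
move=> gE g0 bd cd zcE; have NT := transcendental_NX.
have valF e : coprimez e d ->
    has_value (mr_act alpha1 f) (zeta ^ e) (mr_val f (zeta ^ e) alpha1).
  move=> ed; apply: has_value_act => [|m /f_def fm]; first exact: expfz_neq0.
  exact: (defined_at_conj d_gt1 zeta_prim ed fm).
have valG e : coprimez e d -> has_value (mr_act alpha1 g) (zeta ^ e) 0.
  by move=> /(prim_root_exprz d_gt1 zeta_prim) zed; exact: has_value0_conj zed g0.
have valN F v : has_value F (zeta ^ c) v ->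
    has_value (frac_subst (- 'X%:F) F) (zeta ^ b) v.
  by apply: has_value_subst => //; rewrite zcE; exact/has_valueN/has_valueX.
have Fdiff := has_valueB (valF b bd) (valN _ _ (valF c cd)).
have := has_valueB (has_valueB (valG b bd) (valN _ _ (valG c cd))) Fdiff.
rewrite (act_reflection alpha1 gE) => /has_value_uniq/(_ Fdiff).
(* At [zeta ^ b] the reflection identity reads [- D = D], with [D] the difference of the two values,
   so [D = 0] in characteristic zero. *)
move/eqP; rewrite subrr sub0r eqNr subr_eq0 => /eqP//.
Qed.

End Main.

(** * The shift of exponents by [d / 2], and the theorem *)

Lemma prim_root_half (C : fieldType) (e : nat) (z : C) : (0 < e)%N ->
  (e * 2).-primitive_root z -> z ^+ e = -1.
Proof.
move=> e_gt0 zd; have := prim_expr_order zd; rewrite exprM => /eqP.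
rewrite sqrf_eq1 => /orP[|/eqP//]; rewrite -(prim_order_dvd zd) => /dvdn_leq.
by move=> /(_ e_gt0); rewrite muln2 -addnn -{3}[e]addn0 leq_add2l leqNgt e_gt0.
Qed.

(** Being prime to [4k] means being prime to [2] and to [2k], and adding [2k] affects neither. *)
Lemma coprimez_shift (k : nat) (b : int) :
  coprimez b (4 * k)%N -> coprimez (b + (2 * k)%N) (4 * k)%N.
Proof.
have shift (m q : int) : coprimez (b + q * m) m = coprimez b m.
  by rewrite !(coprimez_sym _ m) /coprimez addrC gcdzMDl.
have -> : (4 * k)%N%:Z = 2%N%:Z * (2 * k)%N%:Z by rewrite -PoszM mulnA.
rewrite !coprimezMr => /andP[b2 b2k]; apply/andP; split.
  by rewrite PoszM mulrC shift.
by rewrite -[X in b + X]mul1r shift.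
Qed.

(** Write [b - c = 2k t]: either [t] is even, or [t + q] is. The shift is [2k q] because, for
    [q = d / d1] and [k = d0], this is [d / 2]. *)
Lemma modz_half (k q : nat) (b c : int) : odd q -> (b = c %[mod (2 * k)%N])%Z ->
  (b = c %[mod (4 * k)%N])%Z \/ (b + (2 * k * q)%N = c %[mod (4 * k)%N])%Z.
Proof.
move=> q_odd /eqP; rewrite eqz_mod_dvd => /dvdzP[t bcE].
have [t_even|t_odd] := boolP (2 %| t)%Z; [left|right]; apply/eqP; rewrite eqz_mod_dvd.
  have [s tE] := dvdzP t_even; apply/dvdzP; exists s.
  by rewrite bcE tE -mulrA -PoszM mulnA.
have : (2 %| t + q%:Z)%Z.
  by move: t_odd q_odd; lia.
move=> /dvdzP[s sE]; apply/dvdzP; exists s.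
rewrite addrAC bcE [(_ * q)%N]mulnC [Posz (q * _)]PoszM -mulrDl sE -mulrA -PoszM.
by rewrite mulnA.
Qed.

Theorem theorem4p5 (R : realType) (d d1 : nat) (zeta : R[i]) (f : Qx)
    (alpha alpha1 alpha2 : ZZnz)
    (d_gt1 : (1 < d)%N) (d1_dvd : (d1 %| d)%N)
    (zeta_prim : d.-primitive_root zeta)
    (f_ann : mr_of nz_one + mr_of nz_mone \in Ann f)
    (alphaE : alpha = alpha1 * alpha2)
    (f_def : forall a : nzint, a \in mr_supp alpha1 ->
       defined_at f (zeta ^ nzval a))
    (alpha1_inv : forall h : nzint, class_in (ker_units d d1) h ->
       exists2 r : ZZnz, principal_ideal (mr_of nz_one + mr_of nz_mone) r &
         phi_ d ((mr_of h - mr_of nz_one) * alpha1) = phi_ d r)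
    (alpha2_coprime : forall a : nzint, a \in mr_supp alpha2 ->
       coprimez (nzval a) d) :
  (mr_congr d1 alpha2 0 -> Cyclotomic_factor d (mr_act alpha f)) /\
  (forall (g : Qx) (d0 : nat),
     g = f - frac_subst (- 'X%:F) f ->
     d1 = (4 * d0)%N -> odd (d %/ d1) ->
     has_value (mr_act alpha1 g) zeta 0 ->
     mr_congr (d1 %/ 2) alpha2 0 ->
     Cyclotomic_factor d (mr_act alpha f)).
Proof.
rewrite alphaE; split=> [|g d0 gE d1E q_odd g0].
  apply: (Cyclotomic_factor_act d_gt1 zeta_prim f_def alpha2_coprime) => b c.
  exact: mr_val_unit_congr.
apply: (Cyclotomic_factor_act d_gt1 zeta_prim f_def alpha2_coprime) => b c bd cd.
have -> : (d1 %/ 2)%N = (2 * d0)%N by rewrite d1E -[4%N]/(2 * 2)%N -mulnA mulKn.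
set q := (d %/ d1)%N in q_odd.
have dE : d = (4 * (d0 * q))%N by rewrite mulnA -d1E mulnC divnK.
move=> /(modz_half q_odd)[|]; rewrite -d1E; first
  exact: (mr_val_unit_congr d_gt1 d1_dvd zeta_prim f_ann).
(* Here [e = d / 2], so [zeta ^ e = -1]. As [b + e = c] mod [d1], it remains to compare the values
   at [zeta ^ b] and [zeta ^ (b + e) = - zeta ^ b]. *)
set e := (2 * d0 * q)%N => bc.
have be : coprimez (nzval b + e) d.
  by rewrite dE /e -mulnA; apply: coprimez_shift; rewrite -dE.
rewrite -(mr_val_unit_congr d_gt1 d1_dvd zeta_prim f_ann alpha1_inv be cd bc).
apply: (mr_val_opp d_gt1 zeta_prim f_def gE g0) => //.
have e_gt0 : (0 < e)%N.
  by move: (ltnW d_gt1); rewrite dE /e -mulnA !muln_gt0.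
have dE2 : d = (e * 2)%N by rewrite dE /e; lia.
rewrite expfzDr; last exact: prim_root_neq0 zeta_prim.
rewrite -[zeta ^ e]/(zeta ^+ e) (prim_root_half e_gt0) ?mulrN1 //.
by rewrite -dE2.
Qed.
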